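(* Let $\mathcal{A}=(Q,X,\pi,\lambda)$ be a Mealy automaton with $m$ states and $n$ letters, with fixed orderings of $Q$ and $X$, and let $(C_{\mathcal A},R_{\mathcal A})$ be its associated matched matrices. Then the following hold. (1) $\mathcal{A}$ is invertible if and only if $R_{\mathcal A}$ is row-Latin. (2) $\mathcal{A}$ is reversible if and only if $C_{\mathcal A}$ is column-Latin. (3) $\mathcal{A}$ is coreversible if and only if $C_{\mathcal A}$ and $R_{\mathcal A}$ are orthogonal. (4) $\mathcal{A}$ is bireversible if and only if $(C_{\mathcal A},R_{\mathcal A})$ is a cooperative pair.
   Context: $m,n$ are positive integers and $[d]=\{1,\dots,d\}$. A Mealy automaton is a tuple $(Q,X,\pi,\lambda)$ with $Q$, $X$ finite sets (states, letters), $\pi\colon Q\times X\to Q$ and $\lambda\colon Q\times X\to X$. Its transition set is $E=\{(q,x,\pi(q,x),\lambda(q,x)): q\in Q,x\in X\}$. It is: invertible if for all $q\in Q,y\in X$ there is exactly one element of $E$ of the form $(q,\cdot,\cdot,y)$; reversible if for all $x\in X,r\in Q$ there is exactly one element of $E$ of the form $(\cdot,x,r,\cdot)$; coreversible if for all $r\in Q,y\in X$ there is exactly one element of $E$ of the form $(\cdot,\cdot,r,y)$; bireversible if it is invertible, reversible and coreversible. Fix orderings $(q_1,\dots,q_m)$ of $Q$ and $(x_1,\dots,x_n)$ of $X$. The associated matched matrices are the $m\times n$ matrices $C_{\mathcal A}$ (entries in $[m]$) and $R_{\mathcal A}$ (entries in $[n]$) with $C_{\mathcal A}(i,j)=k$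 where $\pi(q_i,x_j)=q_k$, and $R_{\mathcal A}(i,j)=\ell$ where $\lambda(q_i,x_j)=x_\ell$. $C_{\mathcal A}$ is column-Latin if every element of $[m]$ appears exactly once in each column; $R_{\mathcal A}$ is row-Latin if every element of $[n]$ appears exactly once in each row; $C_{\mathcal A}$ and $R_{\mathcal A}$ are orthogonal if every element of $[m]\times[n]$ appears exactly once among the pairs $(C_{\mathcal A}(i,j),R_{\mathcal A}(i,j))$, $(i,j)\in[m]\times[n]$. $(C_{\mathcal A},R_{\mathcal A})$ is a cooperative pair if $C_{\mathcal A}$ is column-Latin, $R_{\mathcal A}$ is row-Latin, and they are orthogonal. *)

(* Defs.v *)
From mathcomp Require Import all_boot matrix.

Set Implicit Arguments.
Unset Strict Implicit.
Unset Printing Implicit Defensive.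

Record mealy := Mealy {
  state : finType;
  letter : finType;
  trans : state -> letter -> state;
  output : state -> letter -> letter
}.

Section Mealy.
Variable A : mealy.

Definition transition : predArgType := (state A * letter A * state A * letter A)%type.

Definition src (e : transition) : state A := e.1.1.1.
Definition inletter (e : transition) : letter A := e.1.1.2.
Definition dst (e : transition) : state A := e.1.2.
Definition outletter (e : transition) : letter A := e.2.

Definition transitions : {set transition} :=
  [set (q, x, trans q x, output q x) | q : state A, x : letter A].

Definition invertible : Prop :=
  forall (q : state A) (y : letter A),
    exists! e : transition, [/\ e \in transitions, src e = q & outletter e = y].

Definition reversible : Prop :=
  forall (x : letter A) (r : state A),
    exists! e : transition, [/\ e \in transitions, inletter e = x & dst e = r].

Definition coreversible : Prop :=
  forall (r : state A) (y : letter A),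
    exists! e : transition, [/\ e \in transitions, dst e = r & outletter e = y].

Definition bireversible : Prop := [/\ invertible, reversible & coreversible].

End Mealy.

(* An ordering (t_1, ..., t_d) of T is a bijection from 'I_d to T, given with
   its inverse; [d] = {1, ..., d} is represented by 'I_d, so indices start at 0.
   In particular #|T| = d. *)
Record ordering (d : nat) (T : finType) := Ordering {
  elt : 'I_d -> T;
  idx : T -> 'I_d;
  eltK : cancel elt idx;
  idxK : cancel idx elt
}.

Section MatchedMatrices.
Variables (m n : nat) (A : mealy).
Variables (q : ordering m (state A)) (x : ordering n (letter A)).

Definition Cmx : 'M['I_m]_(m, n) :=
  (\matrix_(i, j) idx q (trans (elt q i) (elt x j)))%R.

Definition Rmx : 'M['I_n]_(m, n) :=
  (\matrix_(i, j) idx x (output (elt q i) (elt x j)))%R.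

Lemma CmxP i j k : Cmx i j = k <-> trans (elt q i) (elt x j) = elt q k.
Proof. by rewrite mxE; split=> [<-|->]; rewrite ?idxK ?eltK. Qed.

Lemma RmxP i j l : Rmx i j = l <-> output (elt q i) (elt x j) = elt x l.
Proof. by rewrite mxE; split=> [<-|->]; rewrite ?idxK ?eltK. Qed.

End MatchedMatrices.

Section LatinMatrices.
Variables m n : nat.

Definition column_Latin (C : 'M['I_m]_(m, n)) : Prop :=
  forall (j : 'I_n) (k : 'I_m), exists! i : 'I_m, C i j = k.

Definition row_Latin (R : 'M['I_n]_(m, n)) : Prop :=
  forall (i : 'I_m) (l : 'I_n), exists! j : 'I_n, R i j = l.

Definition orthogonal_matrices (C : 'M['I_m]_(m, n)) (R : 'M['I_n]_(m, n)) : Prop :=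
  forall kl : 'I_m * 'I_n,
    exists! ij : 'I_m * 'I_n, (C ij.1 ij.2, R ij.1 ij.2) = kl.

Definition cooperative_pair (C : 'M['I_m]_(m, n)) (R : 'M['I_n]_(m, n)) : Prop :=
  [/\ column_Latin C, row_Latin R & orthogonal_matrices C R].

End LatinMatrices.

(* Main.v *)
(* The transitions are parametrized by the index pairs (i, j), and each of the three
   unique-existence conditions on transitions is the corresponding condition on
   index pairs (or on j, or on i, when the other index is prescribed). *)
Require Import Defs.
From mathcomp Require Import all_boot matrix.

(** [h] need not be onto: [g] has to invert it from the other side only where [P] holds. This
    matters because the edges form a proper subset of all quadruples in general. *)
Lemma exists_unique_bij (I T : Type) (S : I -> Prop) (P : T -> Prop)
    (h : I -> T) (g : T -> I) :
  cancel h g -> (forall t, P t -> h (g t) = t) -> (forall i, P (h i) <-> S i) ->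
  (exists! t, P t) <-> (exists! i, S i).
Proof.
move=> hK gK PS; split=> [[t [Pt t_uniq]]|[i [Si i_uniq]]].
  exists (g t); split=> [|i /PS/t_uniq ->]; last exact: hK.
  by apply/PS; rewrite gK.
exists (h i); split=> [|t Pt]; first exact/PS.
by rewrite -(gK t Pt) (i_uniq (g t)) //; apply/PS; rewrite gK.
Qed.

Definition edge (A : mealy) (s : state A) (a : letter A) : transition A :=
  (s, a, trans s a, output s a).

Lemma mem_edge (A : mealy) (s : state A) (a : letter A) :
  edge A s a \in transitions A.
Proof. exact: imset2_f. Qed.

(** Target and output are functions of source and input, so these two components recover the whole
    transition. *)
Lemma edgeE (A : mealy) (e : transition A) :
  e \in transitions A -> edge A (src e) (inletter e) = e.
Proof. by case/imset2P=> s a _ _ ->. Qed.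

Section MatchedPair.
Variables (m n : nat) (A : mealy).
Variables (q : ordering m (state A)) (x : ordering n (letter A)).

Lemma invertible_row_Latin : invertible A <-> row_Latin (Rmx q x).
Proof.
have eqv i l : (exists! e : transition A,
      [/\ e \in transitions A, src e = elt q i & outletter e = elt x l]) <->
    (exists! j, Rmx q x i j = l).
  (* The source is prescribed, so only the input letter remains to be recovered from a
     transition. *)
  apply: (exists_unique_bij _ _ _ _ (fun j => edge A (elt q i) (elt x j))
    (fun e => idx x (inletter e))) => [j|e [eE <- _]|j] /=.
  - by rewrite eltK.
  - by rewrite idxK edgeE.
  by split=> [[_ _ /RmxP]|/RmxP oE] //; split=> //; apply: mem_edge.
split=> [H i l|H s y]; first exact/eqv.
(* Every state and letter is the [elt] of its index, so the indexed statement covers them all. *)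
by rewrite -(idxK q s) -(idxK x y); apply/eqv.
Qed.

Lemma reversible_column_Latin : reversible A <-> column_Latin (Cmx q x).
Proof.
have eqv j k : (exists! e : transition A,
      [/\ e \in transitions A, inletter e = elt x j & dst e = elt q k]) <->
    (exists! i, Cmx q x i j = k).
  (* Here the input letter is prescribed and the source varies. *)
  apply: (exists_unique_bij _ _ _ _ (fun i => edge A (elt q i) (elt x j))
    (fun e => idx q (src e))) => [i|e [eE <- _]|i] /=.
  - by rewrite eltK.
  - by rewrite idxK edgeE.
  by split=> [[_ _ /CmxP]|/CmxP dE] //; split=> //; apply: mem_edge.
split=> [H j k|H y r]; first exact/eqv.
by rewrite -(idxK x y) -(idxK q r); apply/eqv.
Qed.

Lemma coreversible_orthogonal :
  coreversible A <-> orthogonal_matrices (Cmx q x) (Rmx q x).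
Proof.
have eqv k l : (exists! e : transition A,
      [/\ e \in transitions A, dst e = elt q k & outletter e = elt x l]) <->
    (exists! ij, (Cmx q x ij.1 ij.2, Rmx q x ij.1 ij.2) = (k, l)).
  (* Neither source nor input is prescribed, so both indices are parameters. *)
  apply: (exists_unique_bij _ _ _ _ (fun ij => edge A (elt q ij.1) (elt x ij.2))
    (fun e => (idx q (src e), idx x (inletter e)))) => [[i j]|e [eE _ _]|[i j]] /=.
  - by rewrite !eltK.
  - by rewrite !idxK edgeE.
  split=> [[_ /CmxP -> /RmxP -> //]|[/CmxP dE /RmxP oE]].
  by split=> //; apply: mem_edge.
split=> [H [k l]|H r y]; first exact/eqv.
by rewrite -(idxK q r) -(idxK x y); apply/eqv.
Qed.

End MatchedPair.

Theorem theorem1p2 (m n : nat) (hm : 0 < m) (hn : 0 < n) (A : mealy)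
    (q : ordering m (state A)) (x : ordering n (letter A)) :
  [/\ invertible A <-> row_Latin (Rmx q x),
      reversible A <-> column_Latin (Cmx q x),
      coreversible A <-> orthogonal_matrices (Cmx q x) (Rmx q x)
    & bireversible A <-> cooperative_pair (Cmx q x) (Rmx q x)].
Proof.
have inv := invertible_row_Latin m n A q x.
have rev := reversible_column_Latin m n A q x.
have corev := coreversible_orthogonal m n A q x.
(* The fourth equivalence is the conjunction of the other three; the first two conjuncts come in
   opposite orders on its two sides. *)
split=> //; split=> -[H1 H2 H3]; split.
- exact/rev.
- exact/inv.
- exact/corev.
- exact/inv.
- exact/rev.
- exact/corev.
Qed.
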